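(* Let $t(n,k)$ be the number of paths in $\mathcal{M}_2$ of length $n$ whose end-point has height $k$. The matrix $\mathcal{T}=[t(n,k)]_{n\ge0, k \ge0}$ is the Riordan array $$\mathcal{T}=\left(1+zM(z),\,z(1+zM(z))\right)=\left(C\left(\frac{z}{1+z}\right),\,zC\left(\frac{z}{1+z}\right)\right),$$ where $C(z)=\frac{1-\sqrt{1-4z}}{2z}$ is the generating function of the Catalan numbers $c_n=\frac{1}{n+1}\binom{2n}{n}$, and $M(z)=\frac{1-z-\sqrt{1-2z-3z^2}}{2z^2}$ is the generating function of the Motzkin numbers.
   Context: Let $U=(1,1)$, $H=(1,0)$ and $D_k=(1,-k)$ for $k\ge 1$ (down steps). $\mathcal{M}_2$ is the set of lattice paths in $\mathbb{N}^2$ (with $\mathbb{N}=\{0,1,2,\dots\}$, so paths never go below the $x$-axis) starting at the origin, made of steps $U$, $H$ and $D_k$ ($k\ge1$), in which every down step and every horizontal step, except possibly when it is the last step of the path, is immediately followed by an up step $U$. The empty path belongs to $\mathcal{M}_2$. The length of a path is its number of steps; the height of a point is its ordinate. For formal power series $g,f$ with $g(0)\ne0$, $f(0)=0$, $f'(0)\neq0$, the Riordan array $(g(z),f(z))$ is the infinite lower triangular matrix whose $k$-th column ($k\ge0$) has generating function $g(z)f(z)^k$. *)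

(* Defs.v *)
From HB Require Import structures.
From mathcomp Require Import all_boot all_order all_algebra.
From mathcomp Require Import finmap.
From mathcomp Require Import boolp classical_sets functions cardinality.

Set Implicit Arguments.
Unset Strict Implicit.
Unset Printing Implicit Defensive.

Import Order.TTheory GRing.Theory Num.Theory.
Local Open Scope ring_scope.

(* Formal power series, wrapped in a record because [nat -> R] itself already
   carries the pointwise ring structure. *)
Record fps (R : Type) := FPS { fcoef :> nat -> R }.

HB.instance Definition _ (R : Type) := gen_eqMixin (fps R).
HB.instance Definition _ (R : Type) := gen_choiceMixin (fps R).

Lemma fpsP (R : Type) (f g : fps R) : f =1 g <-> f = g.
Proof. by split=> [|->//]; case: f g => f [g] /= fg; congr FPS; apply/funext. Qed.

Section CourseOfValues.
Variables (T : Type) (x0 : T) (F : seq T -> T).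

Let build n := iter n (fun s => rcons s (F s)) [::].

Definition courseval (n : nat) : T := F (build n).

Lemma coursevalE n : courseval n = F (mkseq courseval n).
Proof.
rewrite {1}/courseval; congr F; elim: n => //= n IHn.
by rewrite -/(build n) mkseqS -IHn.
Qed.
End CourseOfValues.

Section FpsRing.
Variable R : comNzRingType.
Implicit Types f g h : fps R.

Definition fps_const (c : R) : fps R := FPS (fun n => if n is 0%N then c else 0).
Definition fpsX : fps R := FPS (fun n => (n == 1%N)%:R).
Definition fps_add f g : fps R := FPS (fun n => f n + g n).
Definition fps_opp f : fps R := FPS (fun n => - f n).
Definition fps_mul f g : fps R := FPS (fun n => \sum_(i < n.+1) f i * g (n - i)%N).

Fact fps_addA : associative fps_add.
Proof. by move=> f g h; apply/fpsP => n /=; rewrite addrA. Qed.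
Fact fps_addC : commutative fps_add.
Proof. by move=> f g; apply/fpsP => n /=; rewrite addrC. Qed.
Fact fps_add0 : left_id (fps_const 0) fps_add.
Proof. by move=> f; apply/fpsP => -[|n] /=; rewrite add0r. Qed.
Fact fps_addN : left_inverse (fps_const 0) fps_opp fps_add.
Proof. by move=> f; apply/fpsP => -[|n] /=; rewrite addNr. Qed.

HB.instance Definition _ :=
  GRing.isZmodule.Build (fps R) fps_addA fps_addC fps_add0 fps_addN.

Let trunc n f : {poly R} := \poly_(i < n.+1) f i.

Let truncE n f k : (k <= n)%N -> (trunc n f)`_k = f k.
Proof. by move=> kn; rewrite coef_poly ltnS kn. Qed.

Let fps_mulE n f g k : (k <= n)%N -> fps_mul f g k = (trunc n f * trunc n g)`_k.
Proof.
move=> kn; rewrite coefM; apply: eq_bigr => i _.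
rewrite !truncE //; first exact: leq_trans (leq_subr _ _) kn.
by apply: leq_trans kn; rewrite -ltnS.
Qed.

Fact fps_mulC : commutative fps_mul.
Proof. by move=> f g; apply/fpsP => n; rewrite !(@fps_mulE n) // mulrC. Qed.

Fact fps_mulA : associative fps_mul.
Proof.
move=> f g h; apply/fpsP => n; rewrite !(@fps_mulE n) //.
transitivity (trunc n f * (trunc n g * trunc n h))`_n.
  rewrite !coefM; apply: eq_bigr => i _.
  by rewrite [(trunc n (fps_mul g h))`_ _]truncE ?(@fps_mulE n) ?leq_subr.
rewrite mulrA !coefM; apply: eq_bigr => i _; congr (_ * _).
have ile : (i <= n)%N by rewrite -ltnS.
by rewrite [(trunc n (fps_mul f g))`_ _]truncE // (@fps_mulE n).
Qed.

Fact fps_mul1 : left_id (fps_const 1) fps_mul.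
Proof.
move=> f; apply/fpsP => n /=; rewrite big_ord_recl /= mul1r subn0.
by rewrite big1 ?addr0 // => i _; rewrite mul0r.
Qed.

Fact fps_mulDl : left_distributive fps_mul fps_add.
Proof.
move=> f g h; apply/fpsP => n /=.
by rewrite -big_split; apply: eq_bigr => i _; rewrite mulrDl.
Qed.

Fact fps_oner_neq0 : fps_const 1 != 0.
Proof. by apply/eqP => /fpsP /(_ 0%N) /eqP /=; rewrite oner_eq0. Qed.

HB.instance Definition _ := GRing.Zmodule_isComNzRing.Build (fps R)
  fps_mulA fps_mulC fps_mul1 fps_mulDl fps_oner_neq0.

Lemma fps_coefD f g n : (f + g) n = f n + g n. Proof. by []. Qed.
Lemma fps_coefN f n : (- f) n = - f n. Proof. by []. Qed.
Lemma fps_coefM f g n : (f * g) n = \sum_(i < n.+1) f i * g (n - i)%N.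
Proof. by []. Qed.
Lemma fps_coef0 n : (0 : fps R) n = 0. Proof. by case: n. Qed.
Lemma fps_coef1 n : (1 : fps R) n = (n == 0%N)%:R. Proof. by case: n. Qed.

(* f(g(z)); meaningful when g(0) = 0, in which case g ^+ i contributes nothing
   to the n-th coefficient for i > n. *)
Definition fps_comp f g : fps R :=
  FPS (fun n => \sum_(i < n.+1) f i * (g ^+ i) n).

(* The square root of f with constant term 1 (junk value 0 if there is none;
   see [fps_sqrtP]). *)
Definition fps_sqrt f : fps R :=
  xget 0 [set g | g ^+ 2 = f /\ g 0%N = 1]%classic.

End FpsRing.

Arguments fpsX {R}.
Notation "''z'" := fpsX : ring_scope.

Section FpsUnitRing.
Variable R : comUnitRingType.
Implicit Types f g : fps R.

Definition fps_unit : {pred fps R} := fun f => f 0%N \is a GRing.unit.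

Definition fps_inv_rec f (s : seq R) : R :=
  (f 0%N)^-1 *
    ((size s == 0%N)%:R - \sum_(i < size s) f i.+1 * s`_(size s - i.+1)).

Definition fps_inv f : fps R :=
  if fps_unit f then FPS (courseval (fps_inv_rec f)) else f.

Fact fps_mulVx : {in fps_unit, left_inverse 1 fps_inv *%R}.
Proof.
move=> f uf; rewrite /fps_inv ifT //.
apply/fpsP => n; rewrite mulrC fps_coefM fps_coef1 big_ord_recl /= subn0.
rewrite coursevalE /fps_inv_rec size_mkseq mulVKr //.
rewrite -[RHS](subrK (\sum_(i < n) f i.+1 *
  (mkseq (courseval (fps_inv_rec f)) n)`_(n - i.+1))); congr (_ + _).
apply: eq_bigr => i _ /=; rewrite nth_mkseq //.
by rewrite ltn_subrL /=; apply: leq_trans (ltn_ord i).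
Qed.

Fact fps_unitPl f g : g * f = 1 -> fps_unit f.
Proof.
move=> /fpsP /(_ 0%N); rewrite fps_coefM big_ord1 /= => gf.
by apply/unitrPr; exists (g 0%N); rewrite mulrC.
Qed.

Fact fps_inv_out : {in [predC fps_unit], fps_inv =1 id}.
Proof. by move=> f; rewrite inE /= /fps_inv => /negbTE uf; rewrite ifF. Qed.

HB.instance Definition _ := GRing.ComNzRing_hasMulInverse.Build (fps R)
  fps_mulVx fps_unitPl fps_inv_out.

End FpsUnitRing.

Lemma fps_sqrtP (F : fieldType) (f : fps F) : (2 : F) != 0 -> f 0%N = 1 ->
  fps_sqrt f ^+ 2 = f /\ fps_sqrt f 0%N = 1.
Proof.
move=> nz2 f0; rewrite /fps_sqrt.
apply: (@xgetPex _ 0 [set g | g ^+ 2 = f /\ g 0%N = 1]%classic).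
pose rec (s : seq F) := if s is [::] then 1 else
  (f (size s) - \sum_(i < (size s).-1) s`_i.+1 * s`_(size s - i.+1)) / 2.
have s0 : courseval rec 0 = 1 by [].
exists (FPS (courseval rec)); split=> //.
apply/fpsP => -[|n]; rewrite expr2 fps_coefM.
  by rewrite big_ord1 /= s0 mulr1 f0.
rewrite big_ord_recl big_ord_recr /= subn0 subnn s0 mul1r mulr1.
rewrite addrCA -mulr2n -mulr_natr [in X in _ + X]coursevalE.
rewrite {3}/rec; case E: (mkseq _ _) => [|x s].
  by have := congr1 size E; rewrite size_mkseq.
rewrite -E size_mkseq mulfVK //= addrC.
rewrite -[RHS](subrK (\sum_(i < n) (mkseq (courseval rec) n.+1)`_i.+1 *
  (mkseq (courseval rec) n.+1)`_(n.+1 - i.+1))); congr (_ + _).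
apply: eq_bigr => i _; rewrite !nth_mkseq //=.
  by rewrite ltnS subSS leq_subr.
by rewrite ltnS.
Qed.

(* T is the Riordan array (g(z), f(z)): entry (n, k) is [z^n] g(z) f(z)^k. *)
Definition is_riordan (R : comNzRingType) (T : nat -> nat -> R) (g f : fps R) :=
  [/\ g 0%N != 0, f 0%N = 0, f 1%N != 0 &
      forall n k : nat, T n k = (g * f ^+ k) n].

(* [Down j] is the step D_{j+1} = (1, -(j+1)), so that every j is allowed. *)
Inductive step := Up | Level | Down of nat.

(* All steps have abscissa 1, so a step is determined by its ordinate. *)
Definition dy (s : step) : int :=
  match s with Up => 1 | Level => 0 | Down j => - (j.+1)%:Z end.

Definition dy_inv (x : int) : option step :=
  match x with
  | Posz 1 => Some Up | Posz 0 => Some Level | Posz _ => None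
  | Negz j => Some (Down j)
  end.

Fact dyK : pcancel dy dy_inv.
Proof. by case. Qed.

HB.instance Definition _ := Countable.copy step (pcan_type dyK).

Definition height (p : seq step) : int := \sum_(s <- p) dy s.

Definition nonneg_path (p : seq step) : Prop :=
  forall i : nat, 0 <= height (take i p).

Definition in_M2 (p : seq step) : Prop :=
  nonneg_path p /\
  forall i : nat, (i.+1 < size p)%N ->
    nth Up p i != Up -> nth Up p i.+1 = Up.

Definition M2_paths (n k : nat) : set (seq step) :=
  [set p | [/\ in_M2 p, size p = n & height p = k%:Z]]%classic.

(* [Down 0] is the step D_1 = (1, -1). *)
Definition motzkin_paths (n : nat) : set (seq step) :=
  [set p | [/\ nonneg_path p, all (mem [:: Up; Level; Down 0]) p,
               size p = n & height p = 0]]%classic.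

(* [fset_set] returns the empty set on infinite sets; finiteness is proved
   in [M2_paths_finite] and [motzkin_paths_finite]. *)
Definition t (n k : nat) : nat := #|` fset_set (M2_paths n k)|.
Definition motzkin (n : nat) : nat := #|` fset_set (motzkin_paths n)|.

Definition M : fps rat := FPS (fun n => (motzkin n)%:R).

Definition C : fps rat := FPS (fun n => 'C(n.*2, n)%:R / n.+1%:R).

Lemma height_le_size (p : seq step) : height p <= (size p)%:Z.
Proof.
elim: p => [|s p IHp]; first by rewrite /height big_nil.
by rewrite /height big_cons -/(height p) /= -add1n PoszD lerD //; case: s.
Qed.

Lemma finite_bounded_paths (n m : nat) :
  finite_set [set p : seq step | size p = n /\
    all (fun s => if s is Down j then (j < m)%N else true) p]%classic.
Proof.
pose A := [set` (Up :: Level :: map Down (iota 0 m))]%classic.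
elim: n => [|n IHn].
  by apply: (sub_finite_set _ (finite_set1 [::])) => p [/size0nil ->].
have fA : finite_set A by exact: finite_seq.
apply: sub_finite_set (finite_image2 cons fA IHn) => -[|s p] [] //= [sp].
move=> /andP[sm pm]; exists s; last by exists p.
rewrite /A /= !inE; case: s sm => //= j jm.
by apply/mapP; exists j => //; rewrite mem_iota.
Qed.

Lemma nonneg_path_finite (n : nat) :
  finite_set [set p | nonneg_path p /\ size p = n]%classic.
Proof.
apply: sub_finite_set (finite_bounded_paths n n) => p /= [p0 sp].
split=> //; apply/(all_nthP Up) => i ip; case E: (nth Up p i) => [||j] //.
have := p0 i.+1; rewrite (take_nth Up) // E /height -cats1 big_cat big_seq1 /=.
rewrite subr_ge0 => /le_trans /(_ (height_le_size _)).
rewrite size_take ip lez_nat => /leq_trans; apply.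
by rewrite -sp ltnW.
Qed.

Lemma M2_paths_finite (n k : nat) : finite_set (M2_paths n k).
Proof.
by apply: sub_finite_set (nonneg_path_finite n) => p [[? _] ? _].
Qed.

Lemma motzkin_paths_finite (n : nat) : finite_set (motzkin_paths n).
Proof. by apply: sub_finite_set (nonneg_path_finite n) => p []. Qed.

(* Main.v *)
Require Import Defs.
From HB Require Import structures.
From mathcomp Require Import all_boot all_order all_algebra.
From mathcomp Require Import finmap ring lra zify.
From mathcomp Require Import boolp classical_sets cardinality.
Set Implicit Arguments.
Unset Strict Implicit.
Unset Printing Implicit Defensive.
Import Order.TTheory GRing.Theory Num.Theory.
Local Open Scope ring_scope.

(** Why the theorem holds.  Write [G = C (z / (1 + z))].

    On the path side, a path of [M2] either ends with [Up] (or is empty), and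
    then it is an arbitrary path of [M2] followed by [Up], or it ends with a
    level or down step, and then the path before this step is empty or ends with
    [Up].  Lowering the last step by one maps the nonempty paths of length [n]
    not ending with [Up] and ending at height [k + 1] injectively to those
    ending at height [k], and what it misses are the paths ending with [Level]
    ([t_nonupS]).  So, if [T k] is the generating function of the [k]-th column
    of the matrix [t],
      (1 + z) T_0 = T_1 + (1 + z),
      (1 + z) T_(k+1) = T_(k+2) + (z + z^2) T_k.
    Since [T k] has order at least [k], these relations determine every [T k]
    ([riordan_char]); and [G (z G)^k] satisfies them as soon as
    (1 + z) G = (1 + z) + z G^2.  This last relation is the Catalan equation
    C = 1 + z C^2 at [z / (1 + z)] ([comp_catalan_eq]), because composition with
    a series without constant term is multiplicative ([fps_compM]).

    On the Motzkin side, writing [G = 1 + z X] turns the equation for [G] into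
    X = 1 + z X + z^2 X^2.  To identify [X] with [M], count the
    Motzkin prefixes, which may end at any height [k]: removing the last step
    gives a recurrence ([motzkin_prefixS]) whose only solution is [X (z X)^k]
    ([motzkin_char]), and [k = 0] gives [M = X].

    The equation C = 1 + z C^2 is equivalent to S^2 = 1 - 4 z for
    [S = 1 - 2 z C].  The two-term recurrence of the Catalan numbers is a first
    order differential equation for [S], from which one for [S^2] follows that
    [1 - 4 z] satisfies as well ([sqrt_ode]).  The two closed forms are then
    instances of the uniqueness of square roots ([fps_sqrt_unique]). *)

(** * Coefficients and square roots of power series *)

Lemma coefX0 (R : comNzRingType) (f : fps R) : ('z * f) 0%N = 0.
Proof. by rewrite fps_coefM big_ord1 mul0r. Qed.

Lemma coefXS (R : comNzRingType) (f : fps R) n : ('z * f) n.+1 = f n.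
Proof.
rewrite fps_coefM !big_ord_recl /= mul0r add0r mul1r subSS subn0.
by rewrite big1 ?addr0 // => i _; rewrite mul0r.
Qed.

Lemma coefM0 (R : comNzRingType) (f g : fps R) : (f * g) 0%N = f 0%N * g 0%N.
Proof. by rewrite fps_coefM big_ord1. Qed.

Lemma coefXn_lt (R : comNzRingType) (f : fps R) k n :
  (n < k)%N -> ('z ^+ k * f) n = 0.
Proof.
elim: k n => // k IHk [|n] nk; rewrite exprS -mulrA ?coefX0 // coefXS.
exact: IHk.
Qed.

Lemma mulX_inj (R : comNzRingType) : injective (fun f : fps R => 'z * f).
Proof.
by move=> f g /fpsP fg; apply/fpsP => n; have := fg n.+1; rewrite !coefXS.
Qed.

Lemma coefMn (R : comNzRingType) (f : fps R) m n : (f *+ m) n = f n *+ m.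
Proof.
by elim: m => [|m IH]; rewrite ?mulr0n ?fps_coef0 // !mulrS fps_coefD IH.
Qed.

Lemma coef_natM (R : comNzRingType) (f : fps R) m n :
  (m%:R * f) n = m%:R * f n.
Proof. by rewrite !mulr_natl coefMn. Qed.

Lemma coef_sum (R : comNzRingType) I (r : seq I) (P : pred I)
    (F : I -> fps R) n :
  (\sum_(i <- r | P i) F i) n = \sum_(i <- r | P i) F i n.
Proof.
apply: (big_morph (fun f : fps R => f n)) => [f g|]; first exact: fps_coefD.
exact: fps_coef0.
Qed.

(** Two square roots [g], [h] with constant term 1 satisfy (h - g)(h + g) = 0,
    where [h + g] is invertible since its constant term is 2. *)
Lemma fps_sqrt_unique (F : fieldType) (f g : fps F) : (2 : F) != 0 ->
  g ^+ 2 = f -> g 0%N = 1 -> fps_sqrt f = g.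
Proof.
move=> nz2 gf g0; have f0 : f 0%N = 1 by rewrite -gf expr2 coefM0 g0 mulr1.
have [hf h0] := fps_sqrtP nz2 f0; set h := fps_sqrt f in hf h0 *.
have hgU : h + g \is a GRing.unit.
  suff: (h + g) 0%N \is a GRing.unit by [].
  by rewrite unitfE fps_coefD h0 g0.
apply/eqP; rewrite -subr_eq0; apply/eqP/(mulIr hgU).
by rewrite mul0r -subr_sqr hf gf subrr.
Qed.

(** * The Catalan equation *)

(** The operator [z d/dz], preferred to the derivative because it does not shift
    indices: its Leibniz rule comes from n = i + (n - i). *)
Definition theta (R : comNzRingType) (f : fps R) : fps R :=
  FPS (fun n => n%:R * f n).

Lemma coef_theta (R : comNzRingType) (f : fps R) n : theta f n = n%:R * f n.
Proof. by []. Qed.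

Lemma thetaM (R : comNzRingType) (f g : fps R) :
  theta (f * g) = theta f * g + f * theta g.
Proof.
apply/fpsP => n; rewrite coef_theta fps_coefD !fps_coefM.
rewrite mulr_sumr -big_split /=.
apply: eq_bigr => i _; have ile : (i <= n)%N by rewrite -ltnS.
by rewrite -[in n%:R](subnKC ile) natrD; ring.
Qed.

Lemma thetaD (R : comNzRingType) (f g : fps R) :
  theta (f + g) = theta f + theta g.
Proof. by apply/fpsP => n; rewrite /= mulrDr. Qed.

Lemma thetaN (R : comNzRingType) (f : fps R) : theta (- f) = - theta f.
Proof. by apply/fpsP => n; rewrite /= mulrN. Qed.

Lemma theta_nat (R : comNzRingType) m : theta (m%:R : fps R) = 0.
Proof.
apply/fpsP => -[|n]; rewrite coef_theta fps_coef0 ?mul0r // coefMn fps_coef1.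
by rewrite mul0rn mulr0.
Qed.

Lemma thetaX (R : comNzRingType) : theta 'z = 'z :> fps R.
Proof. by apply/fpsP => -[|[|n]]; rewrite /= (mul0r, mulr1, mulr0). Qed.

(** The coefficients satisfy (n + 1) f_(n+1) = 4 (n - 1) f_n, a recurrence that
    propagates the vanishing of the first one. *)
Lemma theta_ode0 (f : fps rat) : f 0%N = 0 ->
  theta f = 'z * (4 * (theta f - f)) -> f = 0.
Proof.
move=> f0 /fpsP fE; apply/fpsP; elim=> [|n IHn]; rewrite fps_coef0 => //.
have := fE n.+1; rewrite coefXS coef_natM fps_coefD fps_coefN /= IHn fps_coef0.
by rewrite mulr0 subr0 mulr0 => /eqP; rewrite mulf_eq0 pnatr_eq0 => /eqP.
Qed.

Lemma catalan_rec n : n.+2%:R * C n.+1 = (4 * n%:R + 2) * C n.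
Proof.
have binE : (n.+1 * 'C(n.+1.*2, n.+1) = 2 * (n.*2.+1 * 'C(n.*2, n)))%N.
  rewrite doubleS -mul_bin_diag /= -bin_sub; last by rewrite -addnn; lia.
  have -> : (n.*2.+1 - n = n.+1)%N by rewrite -addnn; lia.
  by rewrite (mul_bin_diag n.*2.+1 n) mulnA mul2n doubleS.
have nz (m : nat) : m.+1%:R != 0 :> rat by rewrite pnatr_eq0.
rewrite -[C n.+1]/(_ / _) -[C n]/(_ / _) mulrCA mulfV // mulr1.
apply: (mulfI (nz n)); rewrite -(natrM _ n.+1) binE !natrM.
rewrite -[n.*2.+1%:R]natr1 -muln2 natrM.
by field; rewrite nat1r; apply: nz.
Qed.

(** The difference D = S^2 - (1 - 4 z) solves the homogeneous equation
    theta D = 4 z (theta D - D): the defect of the latter is 2 S times the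
    defect of the equation for S, as theta (S^2) = 2 S theta S. *)
Lemma sqrt_ode (S : fps rat) : S 0%N = 1 ->
  theta S = 'z * (4 * theta S - 2 * S) -> S ^+ 2 = 1 - 4 * 'z.
Proof.
move=> S0 /eqP; rewrite -subr_eq0 => /eqP ode; apply/eqP; rewrite -subr_eq0.
apply/eqP/theta_ode0.
  rewrite fps_coefD expr2 coefM0 S0 fps_coefN fps_coefD fps_coefN coef_natM.
  by rewrite fps_coef1 /=; ring.
have theta1 : theta (1 : fps rat) = 0 := theta_nat rat 1.
rewrite !(thetaD, thetaN, thetaM, theta1, thetaX, theta_nat).
apply/eqP; rewrite -subr_eq0; apply/eqP.
by rewrite -[RHS](mulr0 (2 * S)) -[in RHS]ode; ring.
Qed.

(** The Catalan recurrence is the differential equation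
    (1 - 4 z) theta S = - 2 z S of [S = 1 - 2 z C]; the identity S^2 = 1 - 4 z
    it gives is the quadratic equation multiplied by 4 z. *)
Lemma catalan_eq : C = 1 + 'z * C ^+ 2.
Proof.
pose S := 1 - 2 * 'z * C.
have S0 : S 0%N = 1.
  by rewrite /S mulrAC mulrC fps_coefD fps_coefN coefX0 subr0.
have SS n : S n.+1 = - (2 * C n).
  by rewrite /S -mulrA fps_coefD fps_coefN coef_natM coefXS add0r.
have ode : theta S = 'z * (4 * theta S - 2 * S).
  apply/fpsP => -[|n]; first by rewrite coefX0 /= mul0r.
  rewrite coefXS fps_coefD fps_coefN !coef_natM !coef_theta SS.
  case: n => [|n]; first by rewrite S0 -[C 0%N]/('C(0, 0)%:R / 1) bin0; field.
  by rewrite SS; have := catalan_rec n; rewrite -!natr1; lra.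
have SE := sqrt_ode S0 ode.
have nz4 : (4 : fps rat) \is a GRing.unit by rewrite [_ \is a _]unitfE.
apply/mulX_inj/(mulrI nz4)/eqP; rewrite -subr_eq0.
have -> : 4 * ('z * C) - 4 * ('z * (1 + 'z * C ^+ 2)) = 1 - 4 * 'z - S ^+ 2.
  by rewrite /S; ring.
by rewrite SE subrr.
Qed.

(** * Composition with a series without constant term *)

Section Comp.
Variable R : comNzRingType.
Implicit Types (f g w u : fps R) (p : {poly R}).

Fact fps_const_is_zmod_morphism : zmod_morphism (@fps_const R).
Proof. by move=> a b; apply/fpsP => -[|n] /=; rewrite ?subr0. Qed.

Fact fps_const_is_monoid_morphism : monoid_morphism (@fps_const R).
Proof.
split=> // a b; apply/fpsP => -[|n]; rewrite fps_coefM.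
  by rewrite big_ord1.
by rewrite big1 // => -[[|i] ?] _ /=; rewrite ?mulr0 ?mul0r.
Qed.

HB.instance Definition _ :=
  GRing.isZmodMorphism.Build R (fps R) (@fps_const R) fps_const_is_zmod_morphism.
HB.instance Definition _ :=
  GRing.isMonoidMorphism.Build R (fps R) (@fps_const R)
    fps_const_is_monoid_morphism.

Lemma coef_constM (c : R) f n : (fps_const c * f) n = c * f n.
Proof.
rewrite fps_coefM big_ord_recl /= subn0 big1 ?addr0 // => i _.
by rewrite mul0r.
Qed.

Lemma coef_comp f w n : fps_comp f w n = \sum_(i < n.+1) f i * (w ^+ i) n.
Proof. by []. Qed.

(** Up to degree [n] a composition only sees the first coefficients of [f], so
    it can be computed by evaluating any polynomial that agrees with [f] there;
    its other coefficients are harmless because (z u)^i has order at least [i].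
    This gives access to the multiplicativity of polynomial evaluation. *)
Lemma coef_comp_horner f p u n : (forall i, (i <= n)%N -> p`_i = f i) ->
  fps_comp f ('z * u) n = (map_poly (@fps_const R) p).['z * u] n.
Proof.
move=> pf; set N := maxn n.+1 (size p).
have le_size : (size (map_poly (@fps_const R) p) <= N)%N.
  by rewrite leq_max size_poly orbT.
rewrite (horner_coef_wide _ le_size) coef_sum coef_comp.
have le_N : (n.+1 <= N)%N := leq_maxl _ _.
rewrite (big_ord_widen _ (fun i => f i * (('z * u) ^+ i) n) le_N).
rewrite big_mkcond; apply: eq_bigr => i _.
rewrite coef_map coef_constM; case: ltnP => [|ni].
  by rewrite ltnS => /pf->.
by rewrite exprMn coefXn_lt // mulr0.
Qed.

Lemma fps_compM f g u :
  fps_comp (f * g) ('z * u) = fps_comp f ('z * u) * fps_comp g ('z * u).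
Proof.
pose tr n f := \poly_(i < n.+1) f i.
have trE n f' i : (i <= n)%N -> (tr n f')`_i = f' i.
  by rewrite coef_poly ltnS => ->.
apply/fpsP => n; rewrite (@coef_comp_horner _ (tr n f * tr n g)); last first.
  move=> i ile; rewrite coefM fps_coefM; apply: eq_bigr => j _.
  by have := ltn_ord j; rewrite ltnS => jle; rewrite !trE //; lia.
rewrite rmorphM hornerM !fps_coefM; apply: eq_bigr => i _.
have ile : (i <= n)%N by rewrite -ltnS.
by congr (_ * _); apply/esym/coef_comp_horner => j jle; apply: trE; lia.
Qed.

Lemma fps_compD f g w : fps_comp (f + g) w = fps_comp f w + fps_comp g w.
Proof.
apply/fpsP => n /=; rewrite -big_split; apply: eq_bigr => i _.
by rewrite mulrDl.
Qed.

Lemma fps_comp1 w : fps_comp 1 w = 1.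
Proof.
apply/fpsP => n /=; rewrite big_ord_recl big1 => [|i _].
  by rewrite addr0 mul1r.
by rewrite mul0r.
Qed.

Lemma fps_compX u : fps_comp 'z ('z * u) = 'z * u.
Proof.
apply/fpsP => -[|n]; rewrite coef_comp; first by rewrite big_ord1 mul0r coefX0.
rewrite !big_ord_recl big1 => [|i _].
  by rewrite mul0r mul1r add0r addr0 expr1.
by rewrite mul0r.
Qed.
End Comp.

(** * The functional equations of G and X *)

Lemma coef_comp0 (R : comNzRingType) (f w : fps R) : fps_comp f w 0%N = f 0%N.
Proof. by rewrite /= big_ord1 mulr1. Qed.

Lemma X1_unit : (1 + 'z : fps rat) \is a GRing.unit.
Proof. by rewrite [_ \is a _]unitfE. Qed.

Lemma comp_catalan_eq :
  (1 + 'z) * fps_comp C ('z / (1 + 'z)) =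
  (1 + 'z) + 'z * fps_comp C ('z / (1 + 'z)) ^+ 2.
Proof.
set G := fps_comp _ _.
have GE : G = 1 + 'z / (1 + 'z) * G ^+ 2.
  rewrite {1}/G {1}catalan_eq fps_compD fps_comp1 fps_compM fps_compX.
  by rewrite expr2 fps_compM.
by rewrite {1}GE mulrDr mulr1 mulrA [_ * ('z / _)]mulrC (mulrVK X1_unit).
Qed.

(** Substituting [1 + z X] in (1 + z) G = (1 + z) + z G^2 leaves z times the
    Motzkin equation. *)
Lemma comp_catalan_shift : exists2 X : fps rat,
  fps_comp C ('z / (1 + 'z)) = 1 + 'z * X & X = 1 + 'z * X + 'z ^+ 2 * X ^+ 2.
Proof.
have := comp_catalan_eq; set G := fps_comp _ _ => GE.
pose X : fps rat := FPS (fun n => G n.+1).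
have GX : G = 1 + 'z * X.
  apply/fpsP => -[|n]; rewrite fps_coefD ?coefX0 ?coefXS fps_coef1 ?add0r //.
  by rewrite coef_comp0 /= bin0.
exists X => //; apply: mulX_inj; apply/eqP; rewrite -subr_eq0; apply/eqP.
by rewrite -(subrr ((1 + 'z) * G)) [in X in _ = _ - X]GE GX; ring.
Qed.

(** Since G (z G)^k satisfies the same relations as T_k, the differences D_k of
    the two satisfy the homogeneous ones.  Once the coefficients of index less
    than [n] of all the D_k vanish, these say that the n-th coefficient of D_k
    does not depend on [k]; it is 0 for k > n. *)
Lemma riordan_char (G : fps rat) (T : nat -> fps rat) :
  (1 + 'z) * G = (1 + 'z) + 'z * G ^+ 2 ->
  (forall n k, (n < k)%N -> T k n = 0) ->
  (1 + 'z) * T 0%N = T 1%N + (1 + 'z) ->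
  (forall k, (1 + 'z) * T k.+1 = T k.+2 + ('z + 'z ^+ 2) * T k) ->
  forall k, T k = G * ('z * G) ^+ k.
Proof.
move=> GE T0 TE0 TES.
pose D k := T k - G * ('z * G) ^+ k.
suff D0 k : D k = 0 by move=> k; apply/eqP; rewrite -subr_eq0 -/(D k) D0.
have Dlt n j : (n < j)%N -> D j n = 0.
  by move=> nj; rewrite /D fps_coefD fps_coefN T0 // exprMn mulrCA coefXn_lt //.
(* DE0 and DES subtract the relation for G (times z G (z G)^j for DES). *)
have DE0 : D 0%N + 'z * D 0%N = D 1%N.
  apply/eqP; rewrite -subr_eq0; apply/eqP.
  rewrite -(subrr ((1 + 'z) * T 0%N)) [in X in _ = _ - X]TE0.
  rewrite -[LHS]addr0 -(subrr ((1 + 'z) * G)) [in X in _ + (_ - X) = _]GE /D.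
  by ring.
have DES j : D j.+1 + 'z * D j.+1 = D j.+2 + 'z * (D j + 'z * D j).
  apply/eqP; rewrite -subr_eq0; apply/eqP.
  rewrite -(subrr ((1 + 'z) * T j.+1)) [in X in _ = _ - X]TES.
  rewrite -[LHS]addr0 -(mulr0 ('z * G * ('z * G) ^+ j)).
  rewrite -(subrr ((1 + 'z) * G)) [in X in _ + _ * (_ - X) = _]GE /D !exprS.
  by move: (('z * G) ^+ j) => P; ring.
apply/fpsP => n; rewrite fps_coef0.
elim/ltn_ind: n k => n IHn k.
have step j : D j n = D j.+1 n.
  case: n IHn => [|n] IHn; case: j => [|j].
  - by have /fpsP /(_ 0%N) := DE0; rewrite fps_coefD coefX0 addr0.
  - by have /fpsP /(_ 0%N) := DES j; rewrite !fps_coefD !coefX0 !addr0.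
  - by have /fpsP /(_ n.+1) := DE0; rewrite fps_coefD coefXS (IHn n) // addr0.
  have /fpsP /(_ n.+1) := DES j; rewrite !fps_coefD !coefXS fps_coefD.
  rewrite !(IHn n) //.
  by case: n IHn => [|n] IHn; rewrite ?coefX0 ?coefXS ?(IHn n) ?addr0.
have: D (k + n.+1)%N n = 0 by apply: Dlt; lia.
by elim: n.+1 => [|m IHm]; rewrite ?addn0 // addnS -step.
Qed.

(** Every unknown on the right of the recurrence carries a factor [z], so there
    is at most one solution; X (z X)^k is one by the quadratic equation of [X]. *)
Lemma motzkin_char (X : fps rat) (N : nat -> fps rat) :
  X = 1 + 'z * X + 'z ^+ 2 * X ^+ 2 ->
  N 0%N = 1 + 'z * (N 0%N + N 1%N) ->
  (forall k, N k.+1 = 'z * (N k + N k.+1 + N k.+2)) ->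
  forall k, N k = X * ('z * X) ^+ k.
Proof.
move=> XE NE0 NES.
pose Y k := X * ('z * X) ^+ k.
have YE0 : Y 0%N = 1 + 'z * (Y 0%N + Y 1%N).
  by rewrite /Y expr0 expr1 {1}XE; ring.
have YES k : Y k.+1 = 'z * (Y k + Y k.+1 + Y k.+2).
  by rewrite /Y !exprS {1}XE; ring.
move=> k; apply/fpsP => n; rewrite -/(Y k).
elim: n k => [|n IHn] [|k].
- by rewrite NE0 YE0 !fps_coefD !coefX0.
- by rewrite NES YES !coefX0.
- by rewrite NE0 YE0 !fps_coefD !coefXS !fps_coefD !IHn.
- by rewrite NES YES !coefXS !fps_coefD !IHn.
Qed.

(** * Counting sets of paths *)

Section Count.
Local Open Scope classical_set_scope.

Lemma card_fset_setU (T : choiceType) (A B : set T) :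
  finite_set A -> finite_set B -> A `&` B = set0 ->
  #|` fset_set (A `|` B)| = (#|` fset_set A| + #|` fset_set B|)%N.
Proof.
move=> fA fB AB; rewrite fset_setU // cardfsU -fset_setI // AB fset_set0.
by rewrite cardfs0 subn0.
Qed.

Lemma card_fset_set_image (T U : choiceType) (A : set T) (f : T -> U) :
  finite_set A -> {in A &, injective f} ->
  #|` fset_set (f @` A)| = #|` fset_set A|.
Proof.
move=> fA finj; rewrite fset_set_image // card_in_imfset //= => x y.
by rewrite !in_fset_set // => *; apply: finj.
Qed.

Lemma card_rcons_image (s : step) (A : set (seq step)) : finite_set A ->
  #|` fset_set ([set rcons p s | p in A])| = #|` fset_set A|.
Proof.
by move=> fA; apply: card_fset_set_image => // p q _ _; apply: rcons_injl.
Qed.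

End Count.

Lemma height_rcons p s : height (rcons p s) = height p + dy s.
Proof. by rewrite /height -cats1 big_cat big_seq1. Qed.

Lemma nonneg_height p : nonneg_path p -> 0 <= height p.
Proof. by move=> /(_ (size p)); rewrite take_size. Qed.

Lemma nonneg_path_rcons p s :
  nonneg_path (rcons p s) <-> nonneg_path p /\ 0 <= height (rcons p s).
Proof.
split=> [ps|[pP ps] i].
  split; last exact: nonneg_height.
  move=> i; case: (leqP i (size p)) => ip.
    by have := ps i; rewrite -cats1 takel_cat.
  by have := ps (size p); rewrite -cats1 take_size_cat // take_oversize // ltnW.
case: (leqP i (size p)) => ip; first by rewrite -cats1 takel_cat.
by rewrite take_oversize // size_rcons.
Qed.

(** Since the condition on consecutive steps spares the last step, appending [s]
    only constrains the pair formed by the previous last step and [s]. *)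
Lemma in_M2_rcons p s : in_M2 (rcons p s) <->
  [/\ in_M2 p, 0 <= height (rcons p s) & s = Up \/ last Up p = Up].
Proof.
split=> [[/nonneg_path_rcons[pP hs] adj]|[[pP adj] hs sp]].
  split=> //; first split=> // i ip.
    have := adj i; rewrite size_rcons !nth_rcons ip (ltnW ip) ltnS (ltnW ip).
    by apply.
  case: (eqVneq (last Up p) Up) => [->|lp]; [by right|left].
  case: p pP hs adj lp => // s0 p pP hs adj lp.
  have := adj (size p); rewrite size_rcons !nth_rcons [size _]/=.
  by rewrite !ltnSn ltnn eqxx (nth_last Up (s0 :: p)); apply.
split; first exact/nonneg_path_rcons.
move=> i; rewrite size_rcons ltnS leq_eqVlt => /orP[/eqP ip|ip].
  rewrite !nth_rcons -ip ltnSn ltnn eqxx.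
  by rewrite -[i]/(i.+1.-1) ip nth_last; case: sp => [//|->]; rewrite eqxx.
by rewrite !nth_rcons ip (ltnW ip); apply: adj.
Qed.

(** The condition that the new end-point is not below the axis is absorbed by
    its height being the natural number [k]. *)
Lemma M2_paths_rcons n k p s : M2_paths n.+1 k (rcons p s) <->
  [/\ in_M2 p, size p = n, height p = k%:Z - dy s & s = Up \/ last Up p = Up].
Proof.
rewrite /M2_paths /= size_rcons; split=> [[/in_M2_rcons[pM _ sp] [sz] <-]|].
  by split=> //; rewrite height_rcons addrK.
move=> [pM -> hp sp].
have hk : height (rcons p s) = k by rewrite height_rcons hp subrK.
by split=> //; apply/in_M2_rcons; rewrite hk.
Qed.

(** * Last-step recurrence in M2 *)

Section M2.
Local Open Scope classical_set_scope.

(** With [Up] as default value of [last], the empty path counts as ending with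
    [Up]; this makes [M2_up] the paths of [M2] that may be followed by a step
    other than [Up]. *)
Definition M2_up n k : set (seq step) :=
  M2_paths n k `&` [set p | last Up p = Up].
Definition M2_nonup n k : set (seq step) :=
  M2_paths n k `&` [set p | last Up p <> Up].

Definition t_up n k : nat := #|` fset_set (M2_up n k)|.
Definition t_nonup n k : nat := #|` fset_set (M2_nonup n k)|.

Lemma M2_up_finite n k : finite_set (M2_up n k).
Proof. exact/finite_setIl/M2_paths_finite. Qed.
Lemma M2_nonup_finite n k : finite_set (M2_nonup n k).
Proof. exact/finite_setIl/M2_paths_finite. Qed.
Hint Resolve M2_paths_finite M2_up_finite M2_nonup_finite : core.

Lemma t_split n k : t n k = (t_up n k + t_nonup n k)%N.
Proof.
rewrite /t_up /t_nonup -card_fset_setU //.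
  rewrite -setIUr (_ : _ `|` _ = setT) ?setIT //.
  by rewrite -subTset => p _ /=; exact: EM.
by rewrite -subset0 => p /= [[_ pU] [_ /(_ pU)]].
Qed.

Lemma t_upS n k : t_up n.+1 k.+1 = t n k.
Proof.
rewrite /t -(card_rcons_image Up) //; congr #|` fset_set _|.
rewrite eqEsubset; split=> [p [] | _ [p [pM sz hp] <-]].
  case/lastP: p => [[_ //]|p s] /M2_paths_rcons[pM sz hp _].
  rewrite /= last_rcons => sU; exists p; last by rewrite sU.
  by split=> //; rewrite hp sU /=; lia.
split; last by rewrite /= last_rcons.
by apply/M2_paths_rcons; split=> //; [rewrite hp /=; lia|left].
Qed.

Lemma t_upS0 n : t_up n.+1 0 = 0%N.
Proof.
rewrite /t_up (_ : M2_up _ _ = set0) ?fset_set0 //.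
rewrite -subset0 => p [].
case/lastP: p => [[_ //]|p s] /M2_paths_rcons[[pP _] sz hp _].
by rewrite /= last_rcons => sU; have := nonneg_height pP; rewrite hp sU.
Qed.

Lemma t_up0 k : t_up 0 k = (k == 0%N).
Proof.
case: k => [|k] /=.
  rewrite /t_up (_ : M2_up _ _ = [set [::]]) ?fset_set1 ?cardfs1 //.
  rewrite eqEsubset; split=> [p [[_ /size0nil //]]|_ ->].
  split=> //; split=> //; last by rewrite /height big_nil.
  by split=> // i; rewrite /height big_nil.
rewrite /t_up (_ : M2_up _ _ = set0) ?fset_set0 //.
by rewrite -subset0 => p [[_ /size0nil ->]]; rewrite /height big_nil.
Qed.

Lemma t_nonup0 k : t_nonup 0 k = 0%N.
Proof.
rewrite /t_nonup (_ : M2_nonup _ _ = set0) ?fset_set0 //.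
by rewrite -subset0 => p [[_ /size0nil ->]].
Qed.

(** The value on [Up] is chosen so that [lower] is injective and subtracts 1
    from every ordinate. *)
Definition lower (s : step) : step :=
  match s with Up => Level | Level => Down 0 | Down j => Down j.+1 end.

Definition lower_last (p : seq step) : seq step :=
  if rev p is s :: q then rcons (rev q) (lower s) else [::].

Lemma lower_last_rcons p s : lower_last (rcons p s) = rcons p (lower s).
Proof. by rewrite /lower_last rev_rcons revK. Qed.

Lemma dy_lower s : dy (lower s) = dy s - 1.
Proof. by case: s => //= j; lia. Qed.

Lemma lower_inj : injective lower.
Proof. by case=> [||i] [||j] //= [->]. Qed.

(** A path ending with a down step arises by [lower_last] from exactly one path
    ending one unit higher and not with [Up]; removing a final [Level] leaves
    an element of [M2_up]. *)
Lemma t_nonupS n k : t_nonup n.+1 k = (t_nonup n.+1 k.+1 + t_up n k)%N.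
Proof.
rewrite /t_nonup /t_up -(card_rcons_image Level (M2_up_finite n k)).
rewrite -(card_fset_set_image (A := M2_nonup n.+1 k.+1) (f := lower_last)) //;
    last first.
  move=> p q; rewrite !in_setE; case/lastP: p => [[_ //]|p s _].
  case/lastP: q => [[_ //]|q s' _]; rewrite !lower_last_rcons.
  by move=> /rcons_inj[-> /lower_inj ->].
rewrite -card_fset_setU;
    [congr #|` fset_set _| |exact: finite_image|exact: finite_image|].
  rewrite eqEsubset; split=> [p []|_ [[p [pM lp] <-]|[p [[pM sz hp] lp] <-]]].
  - case/lastP: p => [[_ //]|p s] /M2_paths_rcons[pM sz hp sp].
    rewrite /= last_rcons => sU; case: sp => [//|lp].
    case: s sU hp => [//|_ hp|j _ hp].
      by right; exists p => //; split=> //; split=> //; rewrite hp subr0.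
    left; exists (rcons p (if j is j'.+1 then Down j' else Level)); last first.
      by rewrite lower_last_rcons; case: j hp.
    split; last by rewrite /= last_rcons; case: j hp.
    apply/M2_paths_rcons; split=> //; last by right.
    by rewrite hp; case: j hp => [|j] _ /=; lia.
  - move: p pM lp => p.
    case/lastP: p => [[_ //]|p s] /M2_paths_rcons[pM sz hp sp].
    rewrite /= last_rcons lower_last_rcons => sU; case: sp => [//|lp].
    split; last by rewrite /= last_rcons; case: (s).
    apply/M2_paths_rcons; split=> //; last by right.
    by rewrite hp dy_lower; lia.
  - split; last by rewrite /= last_rcons.
    by apply/M2_paths_rcons; split=> //; [rewrite hp subr0|right].
rewrite -subset0 => _ [[p [pM lp] <-] [q _]].
move: p pM lp => p; case/lastP: p => [[_ //]|p s] _.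
by rewrite /= last_rcons lower_last_rcons => sU /rcons_inj[_]; case: s sU.
Qed.

Lemma t_gt n k : (n < k)%N -> t n k = 0%N.
Proof.
move=> nk; rewrite /t (_ : M2_paths _ _ = set0) ?fset_set0 //.
rewrite -subset0 => p [_ sz hp]; have := height_le_size p; rewrite sz hp.
by rewrite lez_nat leqNgt nk.
Qed.
End M2.

(** * Last-step recurrence for Motzkin prefixes *)

Section Motzkin.
Local Open Scope classical_set_scope.

Definition motzkin_prefixes (n k : nat) : set (seq step) :=
  [set p | [/\ nonneg_path p, all (mem [:: Up; Level; Down 0]) p,
               size p = n & height p = k%:Z]].
Definition motzkin_prefix n k : nat := #|` fset_set (motzkin_prefixes n k)|.

Lemma motzkin_prefixes_finite n k : finite_set (motzkin_prefixes n k).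
Proof. by apply: sub_finite_set (nonneg_path_finite n) => p []. Qed.

Lemma motzkin_prefixes_rcons n k p s : motzkin_prefixes n.+1 k (rcons p s) <->
  [/\ nonneg_path p /\ all (mem [:: Up; Level; Down 0]) p, size p = n,
      height p = k%:Z - dy s & s \in [:: Up; Level; Down 0] ].
Proof.
rewrite /motzkin_prefixes /= size_rcons all_rcons; split.
  move=> [/nonneg_path_rcons[pP _] /andP[sp pa] [sz] <-].
  by split=> //; rewrite height_rcons addrK.
move=> [[pM pa] -> hp sp].
have hk : height (rcons p s) = k by rewrite height_rcons hp subrK.
by split=> //; [apply/nonneg_path_rcons; rewrite hk | rewrite pa andbT].
Qed.

Hint Resolve motzkin_prefixes_finite : core.

Lemma motzkin_prefix0 k : motzkin_prefix 0 k = (k == 0%N).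
Proof.
case: k => [|k] /=.
  rewrite /motzkin_prefix (_ : motzkin_prefixes _ _ = [set [::]]);
    first by rewrite fset_set1 cardfs1.
  rewrite eqEsubset; split=> [p [_ _ /size0nil //]|_ ->].
  by split=> // [i|]; rewrite /height big_nil.
rewrite /motzkin_prefix (_ : motzkin_prefixes _ _ = set0) ?fset_set0 //.
by rewrite -subset0 => p [_ _ /size0nil -> ]; rewrite /height big_nil.
Qed.

Lemma motzkin_prefixS n k : motzkin_prefix n.+1 k =
  (motzkin_prefix n k + motzkin_prefix n k.+1 +
   (if k is k'.+1 then motzkin_prefix n k' else 0))%N.
Proof.
pose A := if k is k'.+1 then motzkin_prefixes n k' else set0.
have fA : finite_set A by rewrite /A; case: (k).
have -> : (if k is k'.+1 then motzkin_prefix n k' else 0%N) = #|` fset_set A|.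
  by rewrite /A; case: (k) => //; rewrite fset_set0.
rewrite /motzkin_prefix -(card_rcons_image Level (motzkin_prefixes_finite n k)).
rewrite -(card_rcons_image (Down 0) (motzkin_prefixes_finite n k.+1)).
rewrite -(card_rcons_image Up fA) -!card_fset_setU //; first last.
- by rewrite -subset0 => _ [[p _ <-] [q _ /rcons_inj[]]].
- exact: finite_image.
- exact: finite_image.
- by rewrite -subset0 => _ [[[p _ <-]|[p _ <-]] [q _ /rcons_inj[]]].
- exact: finite_image.
- by rewrite finite_setU; split; exact: finite_image.
congr #|` fset_set _|.
rewrite eqEsubset.
split=> [p|_ [[[p [? ? ? hp] <-]|[p [? ? ? hp] <-]]|[p pA <-]]].
- case/lastP: p => [[_ _ //]|p s] /motzkin_prefixes_rcons[[pM pa] sz hp sp].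
  move: sp hp; rewrite !inE => /or3P[]/eqP-> /= hp.
  + right; exists p => //; rewrite /A; case: (k) hp => [|k'] hp.
      by have := nonneg_height pM; rewrite hp.
    by split=> //; rewrite hp; lia.
  + by left; left; exists p => //; split=> //; rewrite hp subr0.
  + by left; right; exists p => //; split=> //; rewrite hp; lia.
- by apply/motzkin_prefixes_rcons; split=> //; rewrite hp subr0.
- by apply/motzkin_prefixes_rcons; split=> //; rewrite hp /=; lia.
- apply/motzkin_prefixes_rcons; move: pA; rewrite /A; case: (k) => // k'.
  by move=> [? ? ? hp]; split=> //; rewrite hp /=; lia.
Qed.
End Motzkin.

(** * Generating functions *)

(** The paths in [M2_up] have generating function 1 at height 0 and z T_(k-1) at
    height k > 0; substituting this in the differences T_k - T_(k+1), which
    [t_nonupS] computes, leaves relations between the columns alone. *)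
Lemma M2_column_eqs (T : nat -> fps rat) :
  (forall k, T k = FPS (fun n => (t n k)%:R)) ->
  (1 + 'z) * T 0%N = T 1%N + (1 + 'z) /\
  forall k, (1 + 'z) * T k.+1 = T k.+2 + ('z + 'z ^+ 2) * T k.
Proof.
move=> TE; pose E k : fps rat := FPS (fun n => (t_up n k)%:R).
have E0 : E 0%N = 1.
  by apply/fpsP => -[|n]; rewrite /= ?t_up0 ?t_upS0.
have ES j : E j.+1 = 'z * T j.
  by apply/fpsP => -[|n]; rewrite ?coefX0 ?coefXS ?TE /= ?t_up0 ?t_upS.
have TE1 j : T j + E j.+1 = T j.+1 + E j + 'z * E j.
  apply/fpsP => -[|n]; rewrite !fps_coefD ?coefX0 ?coefXS !TE /= -!natrD.
    by rewrite addr0 !t_split !t_nonup0 !addn0 addnC.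
  by congr _%:R; rewrite !t_split t_nonupS; lia.
split=> [|j].
  by have := TE1 0%N; rewrite E0 ES => h; rewrite mulrDl mul1r h; ring.
by have := TE1 j.+1; rewrite !ES => h; rewrite mulrDl mul1r h; ring.
Qed.

(* The closed forms of C and M are stated with the denominators cleared:
   2z and 2z^2 are not invertible power series. *)
Theorem proposition6 :
  [/\ is_riordan (fun n k : nat => (t n k)%:R : rat)
        (1 + 'z * M) ('z * (1 + 'z * M)),
      (1 + 'z * M, 'z * (1 + 'z * M)) =
        (fps_comp C ('z / (1 + 'z)), 'z * fps_comp C ('z / (1 + 'z))),
      2 * 'z * C = 1 - fps_sqrt (1 - 4 * 'z) &
      2 * 'z ^+ 2 * M = 1 - 'z - fps_sqrt (1 - 2 * 'z - 3 * 'z ^+ 2)].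
Proof.
have [X GX XE] := comp_catalan_shift.
have MX : M = X.
  pose N k : fps rat := FPS (fun n => (motzkin_prefix n k)%:R).
  rewrite -[M]/(N 0%N) (motzkin_char XE) ?expr0 ?mulr1 // => [|k].
    apply/fpsP => -[|n];
      rewrite !fps_coefD ?coefX0 ?coefXS fps_coef1 ?fps_coefD /=.
      by rewrite motzkin_prefix0.
    by rewrite motzkin_prefixS addn0 natrD add0r.
  apply/fpsP => -[|n]; rewrite ?coefX0 ?coefXS ?fps_coefD /=.
    by rewrite motzkin_prefix0.
  by rewrite motzkin_prefixS !natrD; ring.
have GM : fps_comp C ('z / (1 + 'z)) = 1 + 'z * M by rewrite MX.
have nz2 : (2 : rat) != 0 by [].
split.
- set G := 1 + 'z * M.
  have G0 : G 0%N = 1 by rewrite fps_coefD coefX0 addr0.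
  split; rewrite ?coefX0 ?coefXS ?G0 // => n k.
  pose T k : fps rat := FPS (fun n => (t n k)%:R).
  have [T0 TS] := M2_column_eqs (T := T) (fun k => erefl).
  rewrite -[LHS]/(T k n) (@riordan_char G T) // => [|m j mj].
    by have := comp_catalan_eq; rewrite GM.
  by rewrite /= t_gt.
- by rewrite GM.
- rewrite (@fps_sqrt_unique _ _ (1 - 2 * 'z * C)) ?subKr //.
    apply/eqP; rewrite -subr_eq0; apply/eqP.
    have CE : C - (1 + 'z * C ^+ 2) = 0 by rewrite -catalan_eq subrr.
    by rewrite -(mulr0 (- (4 * 'z))) -CE; ring.
  by rewrite -mulrA fps_coefD fps_coefN coef_natM coefX0 mulr0 subr0.
- rewrite (@fps_sqrt_unique _ _ (1 - 'z - 2 * 'z ^+ 2 * M)) //.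
  + by ring.
  + apply/eqP; rewrite -subr_eq0; apply/eqP.
    have XE0 : X - (1 + 'z * X + 'z ^+ 2 * X ^+ 2) = 0 by rewrite -XE subrr.
    by rewrite MX -(mulr0 (- (4 * 'z ^+ 2))) -XE0; ring.
  + rewrite -mulrA !fps_coefD !fps_coefN coef_natM expr2 -mulrA coefX0.
    by rewrite fps_coef1 /=; ring.
Qed.
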